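(* Let $\mathbb A$ be the binary array of Construction 3, described in the context, with parameters $n_1,n_2,d$. Then $\mathbb A$ is a positioning array in which the rank distance between any two contiguous $n_1\times n_2$ submatrices (with distinct top-left positions) is at least $d$.
   Context: All matrices are over $\mathbb F_2$ unless stated otherwise; the rank distance between two matrices of the same dimension is $d_R(M_1,M_2)=\mathrm{rank}(M_1-M_2)$. Rows and columns are indexed from $0$, and $M[i,i'][j,j']$ is the contiguous submatrix on rows $i,\dots,i'$ and columns $j,\dots,j'$. $x^t$ denotes the concatenation of $t$ copies of a word $x$; $\log=\log_2$. Parameters. $d\ge1$ is fixed; $m$ is an integer with $m(m-d+1)=\log(n_1n_2)$, $m$ sufficiently large in terms of $d$; $n_1\le n_2$ are both divisible by $m$, with $n_1\ge10m$ and $n_2\ge16m$ (so that the layout below fits). Let $\ell=d\lceil\log d\rceil+2d$ and $u=1^du_0u_1\cdots u_{\lceil\log d\rceil}\in\{0,1\}^\ell$, where $u_i$ is the prefix of length $d$ of $(1^{2^i}0^{2^i})^d$. The marker $P$ is the $4m\times4m$ binary matrix whose main diagonal is $0^{4m-\ell}u$, whose $d\times d$ submatrices at the top-right and bottom-left corners are identity matrices, and all of whose other entries are $0$. Let $\mathcal M\subseteq\mathbb F_2^{m\times m}$ be a linear code of dimension $m(m-d+1)$ in which any two distinct matrices have rank distance at least $d$ (a maximum rank distance code). Put $n_R=\frac{n_1n_2}{m^2}-16$ and $k_R=n_R-24$ (assume $k_R$ is even). Let $q$ be a prime power with $n_R\le q<2^{m(m-d+1)}$, $M=q^{k_R/2}$,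 and $\psi:\mathbb F_q\to\mathcal M\setminus\{0\}$ an arbitrary injective map. Construction 3. Let $(\sigma_0,\dots,\sigma_{M-1})$ be a Gray code: a listing of all vectors of $\mathbb F_q^{k_R/2}$ in which consecutive vectors differ in exactly one coordinate. Take a Reed–Solomon code over $\mathbb F_q$ of length $n_R$, dimension $k_R$ and minimum distance $n_R-k_R+1$ with a systematic encoder (the first $k_R$ symbols of a codeword are the message), and for $0\le i,j\le M-1$ let $c_{ij}$ be the codeword encoding the concatenated message $\sigma_i\sigma_j$. The first $k_R$ symbols of $c_{ij}$ are message symbols, and the last $24$ are check symbols. Let $A_{ij}$ be the $n_1\times n_2$ array, partitioned into aligned $m\times m$ blocks, such that $A_{ij}[0,4m-1][0,4m-1]=P$ and the remaining $n_R$ blocks are the matrices $\psi(c_{ij}[t])$, $0\le t<n_R$, placed according to a fixed bijection between symbol indices $t$ and blocks (the same for all $i,j$), chosen so that for each $h\in\{1,2,3\}$ the region $A_{ij}[n_1-2mh,\,n_1-2m(h-1)-1][n_2-4mh,\,n_2-4m(h-1)-1]$ consists of eight blocks coming from check symbols. Finally $\mathbb A$ is the block array $(A_{ij})_{0\le i,j\le M-1}$, of dimension $(n_1M)\times(n_2M)$. *)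

(* Defs.v *)
From HB Require Import structures.
From mathcomp Require Import all_boot all_order all_algebra.

Set Implicit Arguments.
Unset Strict Implicit.
Unset Printing Implicit Defensive.

Import GRing.Theory.

Definition rank_dist (p q : nat) (A B : 'M['F_2]_(p, q)) : nat :=
  \rank (A - B)%R.

(* The p x q contiguous submatrix of A whose top-left entry is A[x][y].  It is
   padded with zeros out of range, but is only used when x + p <= N1 and
   y + q <= N2. *)
Definition submx_at (N1 N2 p q : nat) (A : 'M['F_2]_(N1, N2)) (x y : nat) :
    'M['F_2]_(p, q) :=
  \matrix_(i, j)
    match insub (x + i), insub (y + j) with
    | Some r, Some s => A r s
    | _, _ => 0%R
    end.

Definition window_pos (N1 N2 n1 n2 : nat) (z : nat * nat) : bool :=
  (z.1 + n1 <= N1) && (z.2 + n2 <= N2).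

Definition positioning_array (N1 N2 n1 n2 : nat) (A : 'M['F_2]_(N1, N2)) :
    Prop :=
  forall z w : nat * nat,
    window_pos N1 N2 n1 n2 z -> window_pos N1 N2 n1 n2 w -> z <> w ->
    submx_at n1 n2 A z.1 z.2 <> submx_at n1 n2 A w.1 w.2.

Definition windows_rank_dist_ge (N1 N2 n1 n2 d : nat)
    (A : 'M['F_2]_(N1, N2)) : Prop :=
  forall z w : nat * nat,
    window_pos N1 N2 n1 n2 z -> window_pos N1 N2 n1 n2 w -> z <> w ->
    d <= rank_dist (submx_at n1 n2 A z.1 z.2) (submx_at n1 n2 A w.1 w.2).

(* up_log 2 d is the ceiling of the base-2 logarithm of d. *)
Definition marker_len (d : nat) : nat := d * up_log 2 d + 2 * d.

Definition marker_piece (d i : nat) : seq 'F_2 :=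
  take d (flatten (nseq d (nseq (2 ^ i) 1%R ++ nseq (2 ^ i) 0%R))).

Definition marker_word (d : nat) : seq 'F_2 :=
  nseq d 1%R ++ flatten [seq marker_piece d i | i <- iota 0 (up_log 2 d).+1].

Definition marker (m d : nat) : 'M['F_2]_(4 * m) :=
  \matrix_(i, j)
    if i == j then nth 0%R (nseq (4 * m - marker_len d) 0%R ++ marker_word d) i
    else if (i < d) && (j == 4 * m - d + i :> nat) then 1%R
    else if (j < d) && (i == 4 * m - d + j :> nat) then 1%R
    else 0%R.

Definition MRD_code (m d : nat) (C : {vspace 'M['F_2]_m}) : Prop :=
  \dim C = m * (m - d + 1) /\
  forall A B, A \in C -> B \in C -> A != B -> d <= rank_dist A B.

Definition n_R (m n1 n2 : nat) : nat := (n1 * n2) %/ m ^ 2 - 16.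
Definition k_R (m n1 n2 : nat) : nat := n_R m n1 n2 - 24.

Definition gray_code (F : finFieldType) (h M : nat) (sigma : 'I_M -> 'rV[F]_h) :
    Prop :=
  bijective sigma /\
  forall i j : 'I_M, j = i.+1 :> nat ->
    #|[set s | sigma i ord0 s != sigma j ord0 s]| = 1.

(* Evaluations at alpha of the polynomials of degree < k.  For alpha injective
   and k <= n, this code has dimension k and minimum distance n - k + 1. *)
Definition reed_solomon (F : finFieldType) (n k : nat) (alpha : 'I_n -> F)
    (c : 'rV[F]_n) : Prop :=
  exists2 p : {poly F}, size p <= k & forall t, c ord0 t = (p.[alpha t])%R.

Definition systematic_RS_encoder (F : finFieldType) (n k : nat)
    (alpha : 'I_n -> F) (enc : 'rV[F]_k -> 'rV[F]_n) : Prop :=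
  forall v : 'rV[F]_k,
    reed_solomon k alpha (enc v) /\
    forall (t : 'I_n) (s : 'I_k), t = s :> nat -> enc v ord0 t = v ord0 s.

(* pos t = (a, b) places symbol t in the m x m block with top-left entry
   (m * a, m * b); the 4 x 4 blocks at the top-left are kept for the marker. *)
Definition block_layout (m n1 n2 : nat)
    (pos : 'I_(n_R m n1 n2) -> 'I_(n1 %/ m) * 'I_(n2 %/ m)) : Prop :=
  [/\ injective pos,
      forall ab, (ab \in codom pos) = ~~ ((ab.1 < 4) && (ab.2 < 4)) &
      forall (t : 'I_(n_R m n1 n2)) (h : nat), 1 <= h <= 3 ->
        n1 - 2 * m * h <= m * (pos t).1 <= n1 - 2 * m * (h - 1) - 1 ->
        n2 - 4 * m * h <= m * (pos t).2 <= n2 - 4 * m * (h - 1) - 1 ->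
        k_R m n1 n2 <= t].

Definition array_of_codeword (F : finFieldType) (d m n1 n2 : nat)
    (psi : F -> 'M['F_2]_m)
    (pos : 'I_(n_R m n1 n2) -> 'I_(n1 %/ m) * 'I_(n2 %/ m))
    (c : 'rV[F]_(n_R m n1 n2)) (A : 'M['F_2]_(n1, n2)) : Prop :=
  submx_at (4 * m) (4 * m) A 0 0 = marker m d /\
  forall t, submx_at m m A (m * (pos t).1) (m * (pos t).2) = psi (c ord0 t).

Definition block_array (n1 n2 M : nat) (A : 'I_M -> 'I_M -> 'M['F_2]_(n1, n2))
    (AA : 'M['F_2]_(n1 * M, n2 * M)) : Prop :=
  forall i j : 'I_M, submx_at n1 n2 AA (n1 * i) (n2 * j) = A i j.

(* Main.v *)
(* Read a window cyclically: every coordinate (a, b) of an n1 x n2 array occurs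
   in it exactly once, and the window borders cut at most one block row and one
   block column.

   Suppose the two markers are displaced by some amount other than 0 modulo
   (n1, n2). If the displacement exceeds 3m in one direction, the 3m x 3m zero
   corner of one marker covers an uncut nonzero codeword of the MRD code in the
   other window. Otherwise the markers overlap. For displacements of opposite
   signs the two bottom-left identities differ by a unitriangular matrix; for
   displacements of the same sign so do the parts 1^d of the diagonals, unless
   the diagonals coincide, and then the word u differs from its shift in at least
   d places.

   If the markers are aligned and the distance is less than d, then any symbol
   that is constant over the tiles met by each window is the same in both
   windows. By the Gray property this covers all message symbols but at most 4,
   and at least 4 check symbols lie in a region cut by neither border. So two
   Reed-Solomon codewords agree in k_R places and coincide. *)

Require Import Defs.
From HB Require Import structures.
From mathcomp Require Import all_boot all_order all_algebra.
From mathcomp Require Import zify.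

Set Implicit Arguments.
Unset Strict Implicit.
Unset Printing Implicit Defensive.

Import GRing.Theory.

(** * Rank of triangular matrices and of sampled submatrices *)

Lemma trig_mxrank (K : fieldType) n (D : 'M[K]_n) :
  (forall i j : 'I_n, i < j -> D i j = 0%R) -> (forall i, D i i != 0%R) ->
  \rank D = n.
Proof.
move=> D0 Dn0; apply/mxrank_unit; rewrite unitmxE det_trig; last first.
  exact/is_trig_mxP.
by rewrite unitfE; apply/prodf_neq0 => i _.
Qed.

Lemma mxrank_mxsub (K : fieldType) m n p q (f : 'I_p -> 'I_m) (g : 'I_q -> 'I_n)
    (A : 'M[K]_(m, n)) : \rank (mxsub f g A) <= \rank A.
Proof.
have -> : mxsub f g A = (rowsub g (rowsub f A)^T)^T%R.
  by apply/matrixP => i j; rewrite !mxE.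
rewrite mxrank_tr; apply: leq_trans (mxrankS (rowsub_sub _ _)) _.
by rewrite mxrank_tr; apply: mxrankS; apply: rowsub_sub.
Qed.

(** * The marker word, read through binary digits of positions *)

Lemma nth_flatten_nseq (T : Type) (x0 : T) (s : seq T) c k :
  k < c * size s ->
  nth x0 (flatten (nseq c s)) k = nth x0 s (k %% size s).
Proof.
elim: c k => [|c IHc] k //=; rewrite mulSn nth_cat => kL.
case: ltnP => ks; first by rewrite modn_small.
by rewrite IHc ?ltn_subLR // -{2}(subnKC ks) modnDl.
Qed.

(** Modulo [2 * e] the quotient by [e] changes by an even number, so the remainder alone decides the
    parity. *)
Lemma odd_divn_modn k e : 0 < e -> (k %% (2 * e) < e) = ~~ odd (k %/ e).
Proof.
move=> e0; rewrite {2}(divn_eq k (2 * e)) mulnA divnMDl // oddD oddM andbF /=.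
have kb : k %% (2 * e) < 2 * e by rewrite ltn_pmod // muln_gt0.
case: ltnP => h; first by rewrite divn_small.
rewrite -(subnK h) divnDr // divnn e0 divn_small //; lia.
Qed.

(** The test of [k] against the half-period [2 ^ i] becomes a statement about binary digit [i] of
    [k], which is easy to follow under a shift. *)
Lemma nth_marker_piece d i k : k < d ->
  nth 0%R (marker_piece d i) k = (~~ odd (k %/ 2 ^ i))%:R%R.
Proof.
move=> kd; rewrite nth_take // nth_flatten_nseq; last first.
  rewrite size_cat !size_nseq; have : 0 < 2 ^ i by rewrite expn_gt0.
  by move: (2 ^ i) => e; nia.
rewrite size_cat !size_nseq nth_cat size_nseq addnn -mul2n -odd_divn_modn ?expn_gt0 //.
by rewrite !nth_nseq; case: ltnP => // _; case: ifP.
Qed.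

Lemma size_marker_piece d i : size (marker_piece d i) = d.
Proof.
rewrite size_take size_flatten /shape map_nseq sumn_nseq.
rewrite size_cat !size_nseq; have : 0 < 2 ^ i by rewrite expn_gt0.
move: (2 ^ i) => e e0.
case: ltnP => //; nia.
Qed.

Lemma marker_word_ones d k : k < d -> nth 0%R (marker_word d) k = 1%R.
Proof. by move=> kd; rewrite nth_cat size_nseq kd nth_nseq kd. Qed.

Lemma marker_word_piece d i k : i <= up_log 2 d -> k < d ->
  nth 0%R (marker_word d) (d + d * i + k) = (~~ odd (k %/ 2 ^ i))%:R%R.
Proof.
move=> iL kd; rewrite /marker_word nth_cat size_nseq -addnA ltnNge leq_addr /=.
rewrite addKn -(nth_marker_piece i kd).
(* The first index [b] is general so that the induction can drop one piece of length [d] at a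
   time. *)
have aux L b j : j <= L ->
    nth 0%R (flatten [seq marker_piece d e | e <- iota b L.+1]) (d * j + k)
    = nth 0%R (marker_piece d (b + j)) k.
  elim: L b j => [|L IHL] b [|j] // jL; rewrite /= nth_cat size_marker_piece.
  - by rewrite muln0 kd addn0.
  - by rewrite muln0 kd addn0.
  by rewrite mulnS -addnA ltnNge leq_addr /= addKn -addSnnS; apply: IHL.
exact: aux.
Qed.

Lemma odd_divn_shift del k i : odd (del %/ 2 ^ i) -> 2 ^ i %| del -> del <= k ->
  odd (k %/ 2 ^ i) = ~~ odd ((k - del) %/ 2 ^ i).
Proof.
move=> o dv dk.
by rewrite -{1}(subnK dk) divnDr // oddD o addbT.
Qed.

(* For a shift del < d, a word of period 2^(i+1) whose half-periods are
   complementary changes at every position when 2^i is the exact power of 2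
   dividing del; the del positions that the shift moves out of u_i are supplied
   by the initial 1^d. *)
Lemma marker_word_shift d del : 0 < del ->
  exists kap : nat -> nat,
  [/\ forall i, i < d -> kap i < marker_len d,
      forall i j, i < d -> j < d -> kap i = kap j -> i = j &
      forall i, i < d -> nth 0%R (marker_word d) (kap i) !=
        if kap i < del then 0%R else nth 0%R (marker_word d) (kap i - del)].
Proof.
move=> del0; set i0 := logn 2 del.
have dv : 2 ^ i0 %| del by apply: pfactor_dvdnn.
have od : odd (del %/ 2 ^ i0).
  have := pfactor_coprime (isT : prime 2) del0.
  by case=> q; rewrite coprime2n => oq ->; rewrite mulnK ?expn_gt0.
exists (fun i => if i < del then i else d + d * i0 + i).
(* Since [2 ^ i0 <= del < d], the piece [u_i0] exists; for [del >= d] the initial ones alone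
   suffice. *)
have i0L : del < d -> i0 <= up_log 2 d.
  move=> dd; rewrite -(@leq_exp2l 2) //.
  apply: leq_trans (dvdn_leq del0 dv) (leq_trans (ltnW dd) _).
  exact: up_logP.
rewrite /marker_len; split.
- move=> i id; case: (ltnP i del) => h; first by nia.
  have := i0L (leq_ltn_trans h id); nia.
- move=> i j id jd.
  by case: (ltnP i del) => hi; case: (ltnP j del) => hj // e; lia.
move=> i id; case: (ltnP i del) => h; first by rewrite h marker_word_ones.
have dd := leq_ltn_trans h id.
rewrite marker_word_piece ?i0L // ltnNge.
have -> /= : del <= d + d * i0 + i by lia.
have -> : d + d * i0 + i - del = d + d * i0 + (i - del) by lia.
rewrite marker_word_piece ?i0L //; last by lia.
by rewrite (odd_divn_shift od dv h); case: odd.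
Qed.

(** Total indexing by naturals, so that shifted positions are plain sums. *)
Definition entry (N1 N2 : nat) (A : 'M['F_2]_(N1, N2)) (r s : nat) : 'F_2 :=
  match insub r, insub s with
  | Some i, Some j => A i j
  | _, _ => 0%R
  end.

Lemma entry_ord N1 N2 (A : 'M['F_2]_(N1, N2)) (i : 'I_N1) (j : 'I_N2) :
  entry A i j = A i j.
Proof. by rewrite /entry !valK. Qed.

Lemma entry_lt N1 N2 (A : 'M['F_2]_(N1, N2)) r s
    (hr : r < N1) (hs : s < N2) : entry A r s = A (Ordinal hr) (Ordinal hs).
Proof. exact: (entry_ord A (Ordinal hr) (Ordinal hs)). Qed.

Lemma entry_submx N1 N2 p q (A : 'M['F_2]_(N1, N2)) x y r s : r < p -> s < q ->
  entry (submx_at p q A x y) r s = entry A (x + r) (y + s).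
Proof. by move=> hr hs; rewrite entry_lt mxE. Qed.

(** * Two overlapping copies of the marker *)

Section Marker.

Variables m d : nat.
Hypothesis hm : marker_len d + d <= m.
Let mk := entry (marker m d).
(** The index at which [u] starts on the diagonal. By [hm] it is at least [3 * m + d], so the first
    [d] indices stay below it under any shift of at most [3 * m]. *)
Let len := 4 * m - marker_len d.

Let ge_marker_len : 2 * d <= marker_len d.
Proof. by rewrite /marker_len; lia. Qed.

Lemma marker_diag k : k < 4 * m -> mk k k =
  if k < len then 0%R else nth 0%R (marker_word d) (k - len).
Proof.
move=> kL; rewrite /mk entry_lt mxE eqxx /= nth_cat size_nseq -/len.
by case: ifP => // kl; rewrite nth_nseq kl.
Qed.

Lemma marker_off a b : a < 4 * m -> b < 4 * m -> a != b ->
  d <= a -> d <= b -> mk a b = 0%R.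
Proof.
move=> aL bL ab da db; rewrite /mk entry_lt mxE -val_eqE /= (negPf ab).
by rewrite !ltnNge da db.
Qed.

(** The word [u] starts no earlier than [3 * m], and each 1 of a corner identity has a row or column
    index of at least [4 * m - d]. *)
Lemma marker_zero a b : a < 3 * m -> b < 3 * m -> mk a b = 0%R.
Proof.
move=> aL bL.
have aL' : a < 4 * m by lia.
have bL' : b < 4 * m by lia.
have [<-|ab] := eqVneq a b.
  by rewrite marker_diag // ifT // /len; lia.
rewrite /mk entry_lt mxE -val_eqE /= (negPf ab).
by rewrite !ifF //; apply/negbTE/negP => /andP[_ /eqP]; lia.
Qed.

Lemma marker_corner a b : 3 * m < a -> a < 4 * m -> b < len ->
  mk a b = ((b < d)%N && (a == 4 * m - d + b)%N)%:R%R.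
Proof.
move=> aL aL' bL; rewrite /len in bL; have bL' : b < 4 * m by lia.
have [ab|ab] := eqVneq a b.
  rewrite -ab marker_diag // ifT; last by rewrite /len; lia.
  by case: andP => // -[]; lia.
rewrite /mk entry_lt mxE -val_eqE /= (negPf ab).
by rewrite ifF; [case: ifP | lia].
Qed.

Lemma marker_low a b : d <= a -> a <= 3 * m -> b < len ->
  mk a b = 0%R.
Proof.
move=> da aL bL; rewrite /len in bL.
have aL' : a < 4 * m by lia.
have bL' : b < 4 * m by lia.
have [ab|ab] := eqVneq a b.
  by rewrite -ab marker_diag // ifT // /len; lia.
rewrite /mk entry_lt mxE -val_eqE /= (negPf ab).
by rewrite !ifF //; lia.
Qed.

(** The sampled rows show the bottom-left identity of one marker; the other marker has ones only
    where [i = j + be + al], strictly below the diagonal. *)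
Lemma marker_dist_opp al be : al <= 3 * m -> be <= 3 * m ->
  (al, be) <> (0, 0) ->
  exists f g : 'I_d -> nat,
  [/\ forall i, f i + al < 4 * m, forall j, g j + be < 4 * m &
      \rank (\matrix_(i < d, j < d) (mk (f i + al) (g j) - mk (f i) (g j + be)))%R
        = d].
Proof.
move=> alL beL ab.
exists (fun i => 4 * m - d + i - al), (fun j => j : nat).
split=> [i|j|]; [have := ltn_ord i; lia | have := ltn_ord j; lia |].
have E (i j : 'I_d) : (mk (4 * m - d + i - al + al) j
    - mk (4 * m - d + i - al) (j + be))%R
    = ((i == j)%:R - ((i : nat) == j + be + al)%N %:R)%R.
  have := ltn_ord i; have := ltn_ord j => jd idd.
  rewrite subnK; last by lia.
  rewrite marker_corner; try (rewrite /len; lia).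
  congr (_ - _)%R.
    by congr ((nat_of_bool _)%:R)%R; rewrite -val_eqE /=; apply/idP/idP; lia.
  (* A row moved out of the corner rows meets only zeros, and then [al] is too large for
     [i = j + be + al]. *)
  have [h|h] := ltnP (3 * m) (4 * m - d + i - al).
    rewrite marker_corner; try (rewrite /len; lia).
    congr ((nat_of_bool _)%:R)%R; apply/idP/idP; lia.
  rewrite marker_low; try (rewrite /len; lia).
  by rewrite (_ : (_ == _) = false) //; lia.
apply: trig_mxrank => [i j ij|i]; rewrite mxE E.
  rewrite -val_eqE /= ltn_eqF //.
  by rewrite (_ : (_ == _) = false) ?subrr //; lia.
rewrite eqxx (_ : (_ == (_ + al)%N) = false) ?subr0 ?oner_eq0 //.
apply/negbTE/eqP => h; apply: ab; congr pair; lia.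
Qed.

Lemma marker_dist_same al be : al <= 3 * m -> be <= 3 * m ->
  (al, be) <> (0, 0) ->
  exists f g : 'I_d -> nat,
  [/\ forall i, f i + al < 4 * m, forall j, g j + be < 4 * m &
      \rank (\matrix_(i < d, j < d) (mk (f i + al) (g j + be) - mk (f i) (g j)))%R
        = d].
Proof.
move=> alL beL ab.
(* Equal shifts slide the diagonal along itself; sampling the same indices for rows and columns
   leaves a diagonal matrix. *)
have [abE|abN] := eqVneq al be.
  rewrite -abE; have al0 : 0 < al.
    by rewrite lt0n; apply/eqP => a0; apply: ab; rewrite -abE a0.
  have [kap [kL kinj kne]] := marker_word_shift d al0.
  exists (fun i => len + kap i - al), (fun i => len + kap i - al).
  have B (i : 'I_d) := kL i (ltn_ord i).
  split=> [i|i|]; [have := B i; rewrite /len; lia.. |].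
  apply: trig_mxrank => [i j ij|i]; rewrite mxE.
    have kij : kap i != kap j.
      apply/eqP => /(kinj _ _ (ltn_ord i) (ltn_ord j)); lia.
    have := B i; have := B j => bj bi.
    by rewrite !marker_off ?subrr //; rewrite /len; lia.
  rewrite subr_eq0; have bi := B i.
  have kL1 : al <= len + kap i by rewrite /len; lia.
  have kL4 : len + kap i < 4 * m by rewrite /len; lia.
  rewrite subnK // !marker_diag //; last by lia.
  have := kne i (ltn_ord i).
  rewrite (ltnNge _ len) leq_addr /= addKn.
  have [h|h] := ltnP (kap i) al; first by rewrite ifT //; lia.
  rewrite ifF; last by lia.
  by rewrite (_ : len + kap i - al - len = kap i - al) //; lia.
(* The shifted marker shows [1^d]; the other one is zero here unless the sampled row and column
   indices coincide. *)
have E (i j : 'I_d) : len + i - al != len + j - be ->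
   (mk (len + i - al + al) (len + j - be + be) - mk (len + i - al) (len + j - be))%R
   = (i == j)%:R%R.
  have := ltn_ord i; have := ltn_ord j => jd idd fg.
  rewrite !subnK; try (rewrite /len; lia).
  rewrite (@marker_off (_ - _)) ?subr0 //; try (rewrite /len; lia).
  have [<-|ij] := eqVneq i j.
    rewrite marker_diag ?ltnNge ?leq_addr /= ?addKn ?marker_word_ones //.
    by rewrite /len; lia.
  rewrite marker_off // -?val_eqE /= ?eqn_add2l //; rewrite /len; lia.
exists (fun i => len + i - al), (fun i => len + i - be).
split=> [i|i|]; [have := ltn_ord i; rewrite /len; lia.. |].
(* The sign of [al - be] decides on which side of the main diagonal such coincidences fall. *)
have [lt_ab|le_ab] := ltnP al be.
  rewrite -mxrank_tr.
  apply: trig_mxrank => [i j ij|i]; rewrite !mxE E; try (rewrite /len; lia).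
    by rewrite -val_eqE /= gtn_eqF.
  by rewrite eqxx oner_eq0.
apply: trig_mxrank => [i j ij|i]; rewrite !mxE E; try (rewrite /len; lia).
  by rewrite -val_eqE /= ltn_eqF.
by rewrite eqxx oner_eq0.
Qed.

End Marker.

(** * Windows in cyclic coordinates: sampling, tiles and uncut blocks *)

Lemma leq_rank_dist N1 N2 n1 n2 p q (B : 'M['F_2]_(N1, N2)) (z w : nat * nat)
    (f : 'I_p -> nat) (g : 'I_q -> nat) :
  (forall i, f i < n1) -> (forall j, g j < n2) ->
  \rank (\matrix_(i < p, j < q) (entry B (z.1 + f i) (z.2 + g j)
                                 - entry B (w.1 + f i) (w.2 + g j)))%R
    <= rank_dist (submx_at n1 n2 B z.1 z.2) (submx_at n1 n2 B w.1 w.2).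
Proof.
move=> fL gL.
apply: leq_trans (mxrank_mxsub (fun i => Ordinal (fL i))
                               (fun j => Ordinal (gL j)) _).
by apply: eq_leq; congr (\rank _); apply/matrixP => i j; rewrite !mxE.
Qed.

Lemma rank_distC p q (B B' : 'M['F_2]_(p, q)) : rank_dist B B' = rank_dist B' B.
Proof. by rewrite /rank_dist -mxrank_opp opprB. Qed.

(* A window starting at z shows the coordinate a mod n at position [align n z a],
   where a window starting at w shows the coordinate offset n z w + a. *)
Definition align (n z a : nat) : nat := (a + (n - z %% n)) %% n.

Definition offset (n z w : nat) : nat := (w + (n - z %% n)) %% n.

Lemma align_modn n z w a : (w + align n z a) %% n = (offset n z w + a) %% n.
Proof. by rewrite /align /offset modnDmr modnDml addnCA addnC addnAC. Qed.

Lemma offset_sym n z w : 0 < n ->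
  offset n w z = if offset n z w == 0 then 0 else n - offset n z w.
Proof.
move=> n0; rewrite /offset -(modnDml w) -(modnDml z).
have := ltn_pmod z n0; have := ltn_pmod w n0.
move: (z %% n) (w %% n) => a b bL aL.
have mod_lt x y : x < y -> y < n -> (x + (n - y)) %% n = n - (y - x) /\
    (y + (n - x)) %% n = y - x.
  move=> xy yn; split; first by rewrite modn_small; lia.
  have -> : y + (n - x) = n + (y - x) by lia.
  by rewrite modnDl modn_small; lia.
have [ab|ab|ab] := ltngtP a b.
- have [] := mod_lt _ _ ab bL; move=> -> ->.
  by rewrite ifF //; lia.
- have [] := mod_lt _ _ ab aL; move=> -> ->.
  by rewrite ifF; lia.
by rewrite ab subnKC 1?ltnW // modnn.
Qed.

Lemma offset_refl n z : 0 < n -> offset n z z = 0.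
Proof.
move=> n0; rewrite /offset -modnDml subnKC ?modnn //.
exact/ltnW/ltn_pmod.
Qed.

Lemma offset_eq0 n z w : 0 < n -> offset n z w = 0 -> z %% n = w %% n.
Proof.
move=> n0; rewrite /offset -(modnDml w).
have := ltn_pmod z n0; have := ltn_pmod w n0.
move: (z %% n) (w %% n) => a b bL aL.
have [ab|ab|//] := ltngtP a b.
  have -> : b + (n - a) = n + (b - a) by lia.
  by rewrite modnDl modn_small; lia.
by rewrite modn_small; lia.
Qed.

(** A step shorter than [n] crosses at most one multiple of [n], and does so exactly when the
    residue drops. *)
Lemma divn_window n x f : f < n -> (x + f) %/ n = x %/ n + ((x + f) %% n < x %% n).
Proof.
move=> fn; have n0 : 0 < n := leq_ltn_trans (leq0n _) fn.
rewrite divnD // (divn_small fn) addn0 (modn_small fn); congr (_ + nat_of_bool _).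
rewrite -modnDml; have := ltn_pmod x n0; move: (x %% n) => r rL.
have [h|h] := leqP n (r + f); last by rewrite modn_small; lia.
rewrite (_ : r + f = n + (r + f - n)); last by lia.
by rewrite modnDl modn_small; lia.
Qed.

(** The next tile is called for only if [x %% n > 0], and then the window reaches into it. *)
Lemma tile_subproof n M x a : 0 < n -> x + n <= n * M ->
  x %/ n + (a < x %% n) < M.
Proof.
move=> n0 xM; rewrite -(ltn_pmul2l n0) mulnDr.
have := divn_eq x n; rewrite [_ * n]mulnC => xE.
case: ltnP => h /=; lia.
Qed.

(* The tile of the block array (along one axis) in which a window starting at x
   shows the coordinate a mod n. *)
Definition tile n M x (n0 : 0 < n) (hx : x + n <= n * M) (a : nat) : 'I_M :=
  Ordinal (tile_subproof a n0 hx).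

Lemma tile_uncut n M x (n0 : 0 < n) (hx : x + n <= n * M) m b i :
  (b + m <= x %% n) || (x %% n <= b) -> i < m -> tile n0 hx (b + i) = tile n0 hx b.
Proof.
move=> h im; apply: val_inj => /=; congr (_ + nat_of_bool _).
by case/orP: h => h; apply/idP/idP; lia.
Qed.

(** Let [m * q] be the first block boundary from [e] on. Blocks [q] and [q.+1] end within [3 * m] of
    [e], and the cut at [r] can split only one of them. *)
Lemma uncut_block m n e r : 0 < m -> m %| n -> 2 * m <= n ->
  exists k a, [/\ k < n %/ m, a + m <= 3 * m,
    forall i, i < m -> (e + a + i) %% n = m * k + i,
    (m * k + m <= r) || (r <= m * k) &
    3 * m < e -> e < n - 3 * m -> 4 <= k].
Proof.
move=> m0 /dvdnP[N nE] mn.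
have N2 : 1 < N by move: mn; rewrite nE leq_pmul2r.
have [q [q1 q2]] : exists q, e <= m * q /\ m * q < e + m.
  exists ((e + m - 1) %/ m); have := divn_eq (e + m - 1) m.
  have := ltn_pmod (e + m - 1) m0; rewrite [_ * m]mulnC.
  by move: (m * _) => u; lia.
have nm : n %/ m = N by rewrite nE mulnK.
have cut K : ~~ ((m * (K %% N) + m <= r) || (r <= m * (K %% N))) -> r %/ m = K %% N.
  rewrite negb_or -!ltnNge => /andP[h1 h2].
  rewrite -(subnKC (ltnW h2)) mulnC divnMDl // divn_small ?addn0 //; lia.
have cand K : q <= K <= q.+1 -> (m * (K %% N) + m <= r) || (r <= m * (K %% N)) ->
   exists k a, [/\ k < n %/ m, a + m <= 3 * m,
    forall i, i < m -> (e + a + i) %% n = m * k + i,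
    (m * k + m <= r) || (r <= m * k) &
    3 * m < e -> e < n - 3 * m -> 4 <= k].
  move=> /andP[K1 K2] unc; exists (K %% N), (m * K - e).
  have mK1 : m * q <= m * K by rewrite leq_mul2l K1 orbT.
  have mK2 : m * K <= m * q + m by rewrite -mulnSr leq_mul2l K2 orbT.
  have KN : K %% N < N by rewrite ltn_pmod //; lia.
  split=> //; [by rewrite nm | by lia | |].
    move=> i im; rewrite subnKC; last by lia.
    rewrite {1}(divn_eq K N) mulnDr -addnA mulnCA [m * N]mulnC -nE modnMDl.
    rewrite modn_small //.
    apply: (@leq_trans (m * (K %% N).+1)); first by rewrite mulnS; lia.
    by rewrite nE mulnC leq_mul2r KN orbT.
  (* Here [m * K] exceeds [3 * m] and does not wrap around, so the block index is at least 4. *)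
  move=> e1 e2; rewrite modn_small.
    by rewrite -(ltn_pmul2l m0); lia.
  by rewrite -(ltn_pmul2l m0) (mulnC m N) -nE; lia.
have [u|/cut c1] := boolP ((m * (q %% N) + m <= r) || (r <= m * (q %% N))).
  by apply: (cand q) => //; rewrite leqnn leqnSn.
have [u|/cut c2] := boolP ((m * (q.+1 %% N) + m <= r) || (r <= m * (q.+1 %% N))).
  by apply: (cand q.+1) => //; rewrite leqnn leqnSn.
(* Were both blocks cut, [r] would lie in both, forcing [q] and [q.+1] to agree modulo [N > 1]. *)
have /eqP : q + 0 = q + 1 %[mod N] by rewrite addn0 addn1 -c1 -c2.
by rewrite eqn_modDl mod0n modn_small.
Qed.

(** * Distances between windows of the block array *)

Section Windows.

Variables (d m n1 n2 M nb : nat) (F : eqType).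
Variables (psi : F -> 'M['F_2]_m) (pos : 'I_nb -> 'I_(n1 %/ m) * 'I_(n2 %/ m)).
Variables (A : 'I_M -> 'I_M -> 'M['F_2]_(n1, n2)).
Variables (AA : 'M['F_2]_(n1 * M, n2 * M)) (c : 'I_M -> 'I_M -> 'I_nb -> F).
Hypothesis (hm : marker_len d + d <= m) (m0 : 0 < m).
Hypothesis (hn1 : 10 * m <= n1) (hn2 : 16 * m <= n2).
Hypothesis (hn1m : m %| n1) (hn2m : m %| n2).
Hypothesis hAA : block_array A AA.
Hypothesis hmark :
  forall i j, submx_at (4 * m) (4 * m) (A i j) 0 0 = marker m d.
Hypothesis hsymb :
  forall i j t, submx_at m m (A i j) (m * (pos t).1) (m * (pos t).2) = psi (c i j t).
Hypothesis pos_surj : forall ab : 'I_(n1 %/ m) * 'I_(n2 %/ m),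
  ~~ ((ab.1 < 4) && (ab.2 < 4)) -> exists t, pos t = ab.
Hypothesis hrank : forall a, d <= \rank (psi a).
Hypothesis hdist : forall a b, a != b -> d <= \rank (psi a - psi b)%R.

Lemma n1_gt0 : 0 < n1. Proof. by apply: leq_trans hn1; rewrite muln_gt0. Qed.
Lemma n2_gt0 : 0 < n2. Proof. by apply: leq_trans hn2; rewrite muln_gt0. Qed.

Local Notation tile1 := (tile n1_gt0).
Local Notation tile2 := (tile n2_gt0).
Local Notation wdist z w :=
  (rank_dist (submx_at n1 n2 AA z.1 z.2) (submx_at n1 n2 AA w.1 w.2)).

Lemma window_entry x y (hx : x + n1 <= n1 * M) (hy : y + n2 <= n2 * M) f g :
  f < n1 -> g < n2 ->
  entry AA (x + f) (y + g) =
  entry (A (tile1 hx ((x + f) %% n1)) (tile2 hy ((y + g) %% n2)))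
    ((x + f) %% n1) ((y + g) %% n2).
Proof.
move=> fL gL; rewrite -hAA entry_submx ?ltn_pmod ?n1_gt0 ?n2_gt0 //=.
by rewrite -!divn_window // ![_ * (_ %/ _)]mulnC -!divn_eq.
Qed.

(** All tiles carry the same marker, so the tile indices drop out. *)
Lemma marker_entry x y f g a b : x + n1 <= n1 * M -> y + n2 <= n2 * M ->
  f < n1 -> g < n2 -> (x + f) %% n1 = a -> (y + g) %% n2 = b ->
  a < 4 * m -> b < 4 * m ->
  entry AA (x + f) (y + g) = entry (marker m d) a b.
Proof.
move=> hx hy fL gL fE gE aL bL; rewrite (window_entry hx hy) // fE gE.
by rewrite -(hmark (tile1 hx a) (tile2 hy b)) entry_submx.
Qed.

Lemma symbol_entry x y (hx : x + n1 <= n1 * M) (hy : y + n2 <= n2 * M) f g t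
    (i j : 'I_m) :
  f < n1 -> g < n2 ->
  (x + f) %% n1 = m * (pos t).1 + i -> (y + g) %% n2 = m * (pos t).2 + j ->
  entry AA (x + f) (y + g) =
  psi (c (tile1 hx (m * (pos t).1 + i)) (tile2 hy (m * (pos t).2 + j)) t) i j.
Proof.
move=> fL gL fE gE; rewrite (window_entry hx hy) // fE gE.
by rewrite -hsymb -entry_ord entry_submx.
Qed.

Lemma align1_lt z a : align n1 z a < n1.
Proof. by rewrite ltn_pmod ?n1_gt0. Qed.

Lemma align2_lt z a : align n2 z a < n2.
Proof. by rewrite ltn_pmod ?n2_gt0. Qed.

Lemma wdist_far z w :
  window_pos (n1 * M) (n2 * M) n1 n2 z -> window_pos (n1 * M) (n2 * M) n1 n2 w ->
  3 * m < offset n1 z.1 w.1 < n1 - 3 * m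
    \/ 3 * m < offset n2 z.2 w.2 < n2 - 3 * m ->
  d <= wdist z w.
Proof.
move=> /andP[hz1 hz2] /andP[hw1 hw2] far.
have [|k1 [a1 [k1L a1L k1E u1 k14]]] :=
  @uncut_block m n1 (offset n1 z.1 w.1) (w.1 %% n1) m0 hn1m.
  by lia.
have [|k2 [a2 [k2L a2L k2E u2 k24]]] :=
  @uncut_block m n2 (offset n2 z.2 w.2) (w.2 %% n2) m0 hn2m.
  by lia.
(* One far direction already puts the block outside the marker, so it carries a symbol. *)
have [|t tE] := pos_surj (ab := (Ordinal k1L, Ordinal k2L)).
  rewrite negb_and -!leqNgt; apply/orP.
  by case: far => /andP[h1 h2]; [left; apply: k14 | right; apply: k24].
apply: leq_trans (leq_rank_dist AA z w (f := fun i : 'I_m => align n1 z.1 (a1 + i))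
  (g := fun j : 'I_m => align n2 z.2 (a2 + j)) _ _);
  [|by move=> i; apply: align1_lt|by move=> i; apply: align2_lt].
set B := (\matrix_(i, j) _)%R.
suff -> : B = (- psi (c (tile1 hw1 (m * k1)) (tile2 hw2 (m * k2)) t))%R.
  by rewrite mxrank_opp hrank.
apply/matrixP => i j; rewrite !mxE; have := ltn_ord i; have := ltn_ord j => jm im.
have [ai aj] : a1 + i < 3 * m /\ a2 + j < 3 * m by clear - a1L a2L im jm; lia.
have [ai' aj'] : a1 + i < n1 /\ a2 + j < n2 by clear - ai aj hn1 hn2; lia.
have [ai4 aj4] : a1 + i < 4 * m /\ a2 + j < 4 * m by clear - ai aj; lia.
have z1E : (z.1 + align n1 z.1 (a1 + i)) %% n1 = a1 + i.
  by rewrite align_modn offset_refl ?n1_gt0 // add0n modn_small.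
have z2E : (z.2 + align n2 z.2 (a2 + j)) %% n2 = a2 + j.
  by rewrite align_modn offset_refl ?n2_gt0 // add0n modn_small.
have w1E : (w.1 + align n1 z.1 (a1 + i)) %% n1 = m * (pos t).1 + i.
  by rewrite align_modn addnA k1E // tE.
have w2E : (w.2 + align n2 z.2 (a2 + j)) %% n2 = m * (pos t).2 + j.
  by rewrite align_modn addnA k2E // tE.
rewrite (marker_entry hz1 hz2 (align1_lt _ _) (align2_lt _ _) z1E z2E) //.
rewrite (symbol_entry hw1 hw2 (align1_lt _ _) (align2_lt _ _) w1E w2E).
by rewrite marker_zero // sub0r tE (tile_uncut _ _ u1 im) (tile_uncut _ _ u2 jm).
Qed.

(** Reduces overlapping windows to the marker alone: the bounds by [4 * m] keep both sampled copies
    inside it and free of wraparound. *)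
Lemma wdist_shift z w al1 be1 al2 be2 (f g : nat -> nat) (p : nat)
    (u v : 'I_p -> nat) :
  window_pos (n1 * M) (n2 * M) n1 n2 z -> window_pos (n1 * M) (n2 * M) n1 n2 w ->
  (forall a, [/\ f a < n1, (z.1 + f a) %% n1 = (a + al1) %% n1 &
                 (w.1 + f a) %% n1 = (a + be1) %% n1]) ->
  (forall a, [/\ g a < n2, (z.2 + g a) %% n2 = (a + al2) %% n2 &
                 (w.2 + g a) %% n2 = (a + be2) %% n2]) ->
  (forall i, u i + maxn al1 be1 < 4 * m) -> (forall i, v i + maxn al2 be2 < 4 * m) ->
  \rank (\matrix_(i < p, j < p) (entry (marker m d) (u i + al1) (v j + al2) -
     entry (marker m d) (u i + be1) (v j + be2)))%R <= wdist z w.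
Proof.
move=> /andP[hz1 hz2] /andP[hw1 hw2] fE gE uL vL.
apply: leq_trans (leq_rank_dist AA z w (f := f \o u) (g := g \o v) _ _);
  [|by move=> i; case: (fE (u i))|by move=> i; case: (gE (v i))].
apply: eq_leq; congr (\rank _); apply/matrixP => i j; rewrite !mxE /=.
have [f1 f2 f3] := fE (u i); have [g1 g2 g3] := gE (v j).
have [ua ub] : u i + al1 < 4 * m /\ u i + be1 < 4 * m.
  by have := uL i; rewrite addn_maxr gtn_max => /andP.
have [va vb] : v j + al2 < 4 * m /\ v j + be2 < 4 * m.
  by have := vL j; rewrite addn_maxr gtn_max => /andP.
have [m1 m2] : 4 * m <= n1 /\ 4 * m <= n2 by clear - hn1 hn2; lia.
rewrite (marker_entry hz1 hz2 f1 g1 f2 g2) ?modn_small //;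
  try by [apply: leq_trans m1 | apply: leq_trans m2].
rewrite (marker_entry hw1 hw2 f1 g1 f3 g3) ?modn_small //;
  by [apply: leq_trans m1 | apply: leq_trans m2].
Qed.

Lemma aligned_pair n z w : 0 < n ->
  forall a, [/\ align n z a < n, (z + align n z a) %% n = (a + 0) %% n &
                 (w + align n z a) %% n = (a + offset n z w) %% n].
Proof.
move=> n0 a; split; first by rewrite ltn_pmod.
  by rewrite align_modn offset_refl // addnC.
by rewrite align_modn addnC.
Qed.

Lemma aligned_pair_sym n z w : 0 < n ->
  forall a, [/\ align n z a < n, (w + align n z a) %% n = (a + offset n z w) %% n &
                 (z + align n z a) %% n = (a + 0) %% n].
Proof. by move=> n0 a; have [] := aligned_pair z w n0 a. Qed.

Lemma wdist_near_opp z w :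
  window_pos (n1 * M) (n2 * M) n1 n2 z -> window_pos (n1 * M) (n2 * M) n1 n2 w ->
  offset n1 w.1 z.1 <= 3 * m -> offset n2 z.2 w.2 <= 3 * m ->
  (offset n1 w.1 z.1, offset n2 z.2 w.2) <> (0, 0) -> d <= wdist z w.
Proof.
move=> hz hw o1 o2 ne.
have [u [v [uL vL rk]]] := marker_dist_opp hm o1 o2 ne.
rewrite -[X in X <= _]rk.
have := wdist_shift (u := u) (v := v) hz hw
  (aligned_pair_sym w.1 z.1 n1_gt0) (aligned_pair z.2 w.2 n2_gt0).
under eq_mx do rewrite !addn0.
by apply => i; rewrite ?maxn0 ?max0n.
Qed.

Lemma wdist_near_same z w :
  window_pos (n1 * M) (n2 * M) n1 n2 z -> window_pos (n1 * M) (n2 * M) n1 n2 w ->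
  offset n1 w.1 z.1 <= 3 * m -> offset n2 w.2 z.2 <= 3 * m ->
  (offset n1 w.1 z.1, offset n2 w.2 z.2) <> (0, 0) -> d <= wdist z w.
Proof.
move=> hz hw o1 o2 ne.
have [u [v [uL vL rk]]] := marker_dist_same hm o1 o2 ne.
rewrite -[X in X <= _]rk.
have := wdist_shift (u := u) (v := v) hz hw
  (aligned_pair_sym w.1 z.1 n1_gt0) (aligned_pair_sym w.2 z.2 n2_gt0).
under eq_mx do rewrite !addn0.
by apply => i; rewrite ?maxn0.
Qed.

Lemma wdist_misaligned z w :
  window_pos (n1 * M) (n2 * M) n1 n2 z -> window_pos (n1 * M) (n2 * M) n1 n2 w ->
  (z.1 %% n1, z.2 %% n2) <> (w.1 %% n1, w.2 %% n2) -> d <= wdist z w.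
Proof.
move=> hz hw ne.
have [far1|near1] := boolP (3 * m < offset n1 z.1 w.1 < n1 - 3 * m).
  by apply: wdist_far => //; left.
have [far2|near2] := boolP (3 * m < offset n2 z.2 w.2 < n2 - 3 * m).
  by apply: wdist_far => //; right.
have ne0 : ~ (offset n1 z.1 w.1 = 0 /\ offset n2 z.2 w.2 = 0).
  by case=> /(offset_eq0 n1_gt0) e1 /(offset_eq0 n2_gt0) e2; apply: ne; rewrite e1 e2.
have s1 := offset_sym z.1 w.1 n1_gt0; have s2 := offset_sym z.2 w.2 n2_gt0.
have L1 : offset n1 z.1 w.1 < n1 by rewrite ltn_pmod ?n1_gt0.
have L2 : offset n2 z.2 w.2 < n2 by rewrite ltn_pmod ?n2_gt0.
have ne1 (x y : nat) : ~ (x = 0 /\ y = 0) -> (x, y) <> (0, 0).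
  by move=> h [x0 y0]; apply: h.
(* A displacement that is not far is at most [3 * m] in one of the two senses, which [offset_sym]
   exchanges; the four cases are the sign patterns. *)
case: (leqP (offset n1 z.1 w.1) (3 * m)) => c1;
  case: (leqP (offset n2 z.2 w.2) (3 * m)) => c2.
- by rewrite rank_distC; apply: wdist_near_same => //; apply: ne1.
- rewrite rank_distC; apply: wdist_near_opp => //; first by rewrite s2; case: ifP; lia.
  by apply: ne1; rewrite s2; case: eqP; lia.
- apply: wdist_near_opp => //; first by rewrite s1; case: ifP; lia.
  by apply: ne1; rewrite s1; case: eqP; lia.
- apply: wdist_near_same => //; try by rewrite ?s1 ?s2; case: ifP; lia.
  by apply: ne1; rewrite s1; case: eqP; lia.
Qed.

(* The copies of the block of t may be spread over several tiles; its rows and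
   columns still exhibit psi al - psi be as a submatrix of the difference. *)
Lemma symbol_agree z w (hz1 : z.1 + n1 <= n1 * M) (hz2 : z.2 + n2 <= n2 * M)
    (hw1 : w.1 + n1 <= n1 * M) (hw2 : w.2 + n2 <= n2 * M) t al be :
  z.1 = w.1 %[mod n1] -> z.2 = w.2 %[mod n2] -> wdist z w < d ->
  (forall i j, i < m -> j < m ->
    c (tile1 hz1 (m * (pos t).1 + i)) (tile2 hz2 (m * (pos t).2 + j)) t = al /\
    c (tile1 hw1 (m * (pos t).1 + i)) (tile2 hw2 (m * (pos t).2 + j)) t = be) ->
  al = be.
Proof.
move=> e1 e2 lt_d ct; apply: contraTeq lt_d => /hdist ne; rewrite -leqNgt.
apply: leq_trans ne _.
apply: leq_trans (leq_rank_dist AA z w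
  (f := fun i : 'I_m => align n1 z.1 (m * (pos t).1 + i))
  (g := fun j : 'I_m => align n2 z.2 (m * (pos t).2 + j)) _ _);
  [|by move=> i; apply: align1_lt|by move=> i; apply: align2_lt].
have lt_blk n (k : 'I_(n %/ m)) (i : 'I_m) : m * k + i < n.
  apply: (@leq_trans (n %/ m * m)); last exact: leq_divM.
  apply: (@leq_trans (m * k.+1)); first by rewrite mulnS addnC ltn_add2r.
  by rewrite mulnC leq_mul2r ltn_ord orbT.
apply: eq_leq; congr (\rank _); apply/matrixP => i j; rewrite !mxE.
have [al_ be_] := ct i j (ltn_ord i) (ltn_ord j).
have z1E : (z.1 + align n1 z.1 (m * (pos t).1 + i)) %% n1 = m * (pos t).1 + i.
  by rewrite align_modn offset_refl ?n1_gt0 // add0n modn_small ?lt_blk.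
have z2E : (z.2 + align n2 z.2 (m * (pos t).2 + j)) %% n2 = m * (pos t).2 + j.
  by rewrite align_modn offset_refl ?n2_gt0 // add0n modn_small ?lt_blk.
rewrite (symbol_entry hz1 hz2 (align1_lt _ _) (align2_lt _ _) z1E z2E) al_.
(* Windows with equal residues show the same coordinate at the same position, so alignment with [z]
   also serves [w]. *)
rewrite (symbol_entry hw1 hw2 (t := t) (i := i) (j := j)) ?align1_lt ?align2_lt //.
- by rewrite be_.
- by rewrite -modnDml -e1 modnDml.
- by rewrite -modnDml -e2 modnDml.
Qed.

(* The three check regions are pairwise disjoint in rows and in columns, and the
   cuts (at row z.1 mod n1 and column z.2 mod n2) meet at most one each. *)
Lemma check_symbols_agree k z w
    (hz1 : z.1 + n1 <= n1 * M) (hz2 : z.2 + n2 <= n2 * M)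
    (hw1 : w.1 + n1 <= n1 * M) (hw2 : w.2 + n2 <= n2 * M) :
  (forall t h, 1 <= h <= 3 ->
    n1 - 2 * m * h <= m * (pos t).1 <= n1 - 2 * m * (h - 1) - 1 ->
    n2 - 4 * m * h <= m * (pos t).2 <= n2 - 4 * m * (h - 1) - 1 -> k <= t) ->
  z.1 = w.1 %[mod n1] -> z.2 = w.2 %[mod n2] -> wdist z w < d ->
  exists a b (T : 'I_4 -> 'I_nb), [/\ injective T, forall q, k <= T q &
    forall q, c (tile1 hz1 a) (tile2 hz2 b) (T q) =
              c (tile1 hw1 a) (tile2 hw2 b) (T q)].
Proof.
move=> hpos e1 e2 lt_d.
have [h [h13 u1 u2]] : exists h, [/\ 1 <= h <= 3,
    (n1 - 2 * m * h + 2 * m <= z.1 %% n1) || (z.1 %% n1 <= n1 - 2 * m * h) &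
    (n2 - 4 * m * h + 4 * m <= z.2 %% n2) || (z.2 %% n2 <= n2 - 4 * m * h)].
  move: (z.1 %% n1) (z.2 %% n2) => r s; clear - hn1 hn2 m0.
  have cut1 h h' : 0 < h < h' -> h' <= 3 ->
    (n1 - 2 * m * h + 2 * m <= r) || (r <= n1 - 2 * m * h) \/
    (n1 - 2 * m * h' + 2 * m <= r) || (r <= n1 - 2 * m * h') by nia.
  have cut2 h h' : 0 < h < h' -> h' <= 3 ->
    (n2 - 4 * m * h + 4 * m <= s) || (s <= n2 - 4 * m * h) \/
    (n2 - 4 * m * h' + 4 * m <= s) || (s <= n2 - 4 * m * h') by nia.
  have [x1 x2 x3] := And3 (cut1 1 2 isT isT) (cut1 1 3 isT isT) (cut1 2 3 isT isT).
  have [y1 y2 y3] := And3 (cut2 1 2 isT isT) (cut2 1 3 isT isT) (cut2 2 3 isT isT).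
  case: x1 => x1; case: y1 => y1; first by exists 1.
  - case: x3 => x3; first by exists 2.
    by case: y2 => y2; [exists 1 | exists 3].
  - case: y3 => y3; first by exists 2.
    by case: x2 => x2; [exists 1 | exists 3].
  by exists 2.
have [nm1 nm2] : m * (n1 %/ m) = n1 /\ m * (n2 %/ m) = n2.
  by rewrite ![m * _]mulnC !divnK.
have [N1L N2L] : 10 <= n1 %/ m /\ 16 <= n2 %/ m.
  by rewrite !leq_divRL.
(* The upper block row of region [h] supplies the four check symbols. *)
have k1P : n1 %/ m - 2 * h < n1 %/ m by clear - h13 N1L; lia.
have k2P (q : 'I_4) : n2 %/ m - 4 * h + q < n2 %/ m.
  by have := ltn_ord q; clear - h13 N2L; lia.
have k1E : m * (n1 %/ m - 2 * h) = n1 - 2 * m * h.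
  by rewrite mulnBr nm1 mulnCA mulnA.
have k2E q : m * (n2 %/ m - 4 * h + q) = n2 - 4 * m * h + m * q.
  by rewrite mulnDr mulnBr nm2 mulnCA mulnA.
have ex q : exists t, pos t == (Ordinal k1P, Ordinal (k2P q)).
  have [|t tE] := pos_surj (ab := (Ordinal k1P, Ordinal (k2P q)));
    last by exists t; rewrite tE.
  (* The block row is at least [10 - 2 * 3 = 4], hence below the marker. *)
  by rewrite /= negb_and -!leqNgt; apply/orP; left; clear - h13 N1L; lia.
pose T q := xchoose (ex q); have TE q : pos (T q) = _ := eqP (xchooseP (ex q)).
have mh : 4 * m * h <= n2 /\ 2 * m * h <= n1 by clear - hn1 hn2 h13; nia.
have mhS : 2 * m * h = 2 * m * (h - 1) + 2 * m /\ 4 * m * h = 4 * m * (h - 1) + 4 * m.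
  by clear - h13; nia.
have col (q : 'I_4) i : i < m -> m * q + i < 4 * m.
  by have := ltn_ord q; clear; nia.
exists (n1 - 2 * m * h), (n2 - 4 * m * h), T; split.
- move=> q q' /(congr1 pos); rewrite !TE => -[] /eqP.
  by rewrite eqn_add2l => /eqP /val_inj.
- move=> q; apply: (hpos _ h) => //; rewrite TE /= ?k1E ?k2E.
    by clear - mh mhS m0 h13; move: (2 * m * h) (2 * m * (h - 1)) mh mhS; lia.
  have := col q 0 m0; rewrite addn0; clear - mh mhS m0.
  by move: (4 * m * h) (4 * m * (h - 1)) (m * q) mh mhS; lia.
move=> q; apply: (symbol_agree (t := T q) e1 e2 lt_d) => i j im jm; rewrite TE /= k1E k2E.
have jq := col q j jm.
have u1' : (n1 - 2 * m * h + m <= z.1 %% n1) || (z.1 %% n1 <= n1 - 2 * m * h).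
  by clear - u1; move: (z.1 %% n1) (n1 - _) u1 => r u; lia.
rewrite -addnA (tile_uncut _ _ u1' im) (tile_uncut _ _ u2 jq).
rewrite e1 in u1'; rewrite e2 in u2.
by rewrite (tile_uncut _ _ u1' im) (tile_uncut _ _ u2 jq).
Qed.

End Windows.

(** * Agreement counts for Reed-Solomon codewords and Gray codes *)

(** Otherwise the nonzero difference of the two polynomials, of size at most [k], would have [k]
    distinct roots. *)
Lemma reed_solomon_eq (F : finFieldType) n k (alpha : 'I_n -> F)
    (c c' : 'rV[F]_n) :
  injective alpha -> reed_solomon k alpha c -> reed_solomon k alpha c' ->
  k <= #|[set t | c ord0 t == c' ord0 t]| -> c = c'.
Proof.
move=> ainj [p pk pE] [p' pk' pE'] kS.
have [pp|pp] := eqVneq p p'.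
  by apply/rowP => t; rewrite pE pE' pp.
have := @max_poly_roots _ (p - p')%R
  [seq alpha t | t <- enum [set t | c ord0 t == c' ord0 t]].
rewrite subr_eq0 pp map_inj_uniq // enum_uniq size_map -cardE => /(_ isT) H.
have {}H : #|[set t | c ord0 t == c' ord0 t]| < size (p - p')%R.
  apply: H => //; apply/allP => x /mapP[t]; rewrite mem_enum inE => /eqP tE ->.
  by rewrite rootE hornerD hornerN -pE -pE' tE subrr.
have := leq_trans H (size_polyD _ _); rewrite size_polyN ltnNge.
by rewrite (leq_trans _ kS) // geq_max pk pk'.
Qed.

(** The boolean also covers a window lying in a single tile along the axis. *)
Lemma gray_step (F : finFieldType) h M (sigma : 'I_M -> 'rV[F]_h) (i j : 'I_M)
    (b : bool) :
  gray_code sigma -> j = i + b :> nat ->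
  #|[set s | sigma i ord0 s != sigma j ord0 s]| <= 1.
Proof.
case=> _ gray; case: b => ij; first by rewrite gray // ij addn1.
have -> : j = i by apply: val_inj; rewrite /= ij addn0.
by rewrite (_ : [set s | _] = set0) ?cards0 //; apply/setP => s; rewrite !inE eqxx.
Qed.

(** The at most [e] lost message positions are made up for by [e] check positions, disjoint from
    them as their indices start at [k]. *)
Lemma leq_card_agree k e n (kn : k <= n) (E : {set 'I_k}) (T : 'I_e -> 'I_n)
    (S : {set 'I_n}) :
  #|E| <= e -> injective T -> (forall q, k <= T q) ->
  (forall s, s \notin E -> widen_ord kn s \in S) -> (forall q, T q \in S) ->
  k <= #|S|.
Proof.
move=> Ee Tinj kT ES TS.
have winj : injective (widen_ord kn) by move=> x y /(congr1 val) /= /val_inj.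
have dis : [disjoint widen_ord kn @: ~: E & T @: [set: 'I_e]].
  apply/pred0P => t /=; apply/negbTE/negP.
  move=> /andP[/imsetP[s _ ->] /imsetP[q _ /(congr1 val) /=]].
  by move=> sE; have := kT q; rewrite -sE leqNgt ltn_ord.
have sub : (widen_ord kn @: (~: E)) :|: (T @: [set: 'I_e]) \subset S.
  rewrite subUset; apply/andP; split; apply/subsetP => t /imsetP[x].
    by rewrite inE => /ES h ->.
  by move=> _ ->.
apply: leq_trans (subset_leq_card sub).
rewrite cardsU disjoint_setI0 // cards0 subn0 !card_imset // cardsT card_ord.
by rewrite -[X in X <= _]card_ord -(cardsC E) addnC leq_add2l.
Qed.

(** The out-of-range coordinate [n] stands for the first tile, and 0 for the second if the window
    meets two. *)
Lemma tile_two n M x (n0 : 0 < n) (hx : x + n <= n * M) a :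
  tile n0 hx a = tile n0 hx 0 \/ tile n0 hx a = tile n0 hx n.
Proof.
have [h|h] := ltnP a (x %% n); [left | right]; apply: val_inj => /=.
  by rewrite h (leq_ltn_trans _ h).
by rewrite ltnNge h /= ltnNge ltnW // ltn_pmod.
Qed.

Lemma tile_val_eq n M x y (n0 : 0 < n) (hx : x + n <= n * M) (hy : y + n <= n * M) a :
  x = y %[mod n] -> tile n0 hx a = tile n0 hy a -> x = y.
Proof.
move=> xy /(congr1 val) /= /eqP; rewrite xy eqn_add2r => /eqP q.
by rewrite (divn_eq x n) (divn_eq y n) xy q.
Qed.

(* The message coordinates whose symbols differ between two horizontally (or
   vertically) adjacent tiles met by a window. *)
Definition gray_change (F : finFieldType) h n M (sigma : 'I_M -> 'rV[F]_h) x
    (n0 : 0 < n) (hx : x + n <= n * M) : {set 'I_h} :=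
  [set s | sigma (tile n0 hx n) ord0 s != sigma (tile n0 hx 0) ord0 s].

Lemma card_gray_change (F : finFieldType) h n M (sigma : 'I_M -> 'rV[F]_h) x
    (n0 : 0 < n) (hx : x + n <= n * M) :
  gray_code sigma -> #|gray_change sigma n0 hx| <= 1.
Proof.
move=> gray; apply: (gray_step (b := 0 < x %% n)) => //=.
by rewrite [n < _]ltnNge (ltnW (ltn_pmod x n0)) addn0.
Qed.

Lemma gray_unchanged (F : finFieldType) h n M (sigma : 'I_M -> 'rV[F]_h) x
    (n0 : 0 < n) (hx : x + n <= n * M) s a b :
  s \notin gray_change sigma n0 hx ->
  sigma (tile n0 hx a) ord0 s = sigma (tile n0 hx b) ord0 s.
Proof.
rewrite inE negbK => /eqP E.
by case: (tile_two n0 hx a) => ->; case: (tile_two n0 hx b) => ->; rewrite ?E.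
Qed.

Theorem theorem5p4 (d : nat) (hd : 1 <= d) :
  exists m0 : nat, forall (m n1 n2 : nat)
    (hm : m0 <= m)
    (hlog : n1 * n2 = 2 ^ (m * (m - d + 1)))
    (hn12 : n1 <= n2) (hn1m : m %| n1) (hn2m : m %| n2)
    (hn1 : 10 * m <= n1) (hn2 : 16 * m <= n2)
    (hk : ~~ odd (k_R m n1 n2))
    (C : {vspace 'M['F_2]_m}) (hC : MRD_code d C)
    (F : finFieldType) (hq : n_R m n1 n2 <= #|F| < 2 ^ (m * (m - d + 1)))
    (psi : F -> 'M['F_2]_m) (hpsi_inj : injective psi)
    (hpsi : forall a, psi a \in C /\ psi a <> 0%R)
    (sigma : 'I_(#|F| ^ (k_R m n1 n2)./2) -> 'rV[F]_((k_R m n1 n2)./2))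
    (hsigma : gray_code sigma)
    (alpha : 'I_(n_R m n1 n2) -> F) (halpha : injective alpha)
    (enc : 'rV[F]_((k_R m n1 n2)./2 + (k_R m n1 n2)./2) ->
           'rV[F]_(n_R m n1 n2))
    (henc : systematic_RS_encoder alpha enc)
    (pos : 'I_(n_R m n1 n2) -> 'I_(n1 %/ m) * 'I_(n2 %/ m))
    (hpos : block_layout pos)
    (A : 'I_(#|F| ^ (k_R m n1 n2)./2) -> 'I_(#|F| ^ (k_R m n1 n2)./2) ->
         'M['F_2]_(n1, n2))
    (hA : forall i j,
      array_of_codeword d psi pos (enc (row_mx (sigma i) (sigma j))) (A i j))
    (AA : 'M['F_2]_(n1 * #|F| ^ (k_R m n1 n2)./2,
                    n2 * #|F| ^ (k_R m n1 n2)./2))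
    (hAA : block_array A AA),
  positioning_array n1 n2 AA /\ windows_rank_dist_ge n1 n2 d AA.
Proof.
(* Beyond the [3 * m] zero corner the marker must have room for [u] and [d] more indices. *)
exists (marker_len d + d) => m n1 n2 hm _ _ hn1m hn2m hn1 hn2 hk C hC F _ psi
  psi_inj hpsi sigma hsigma alpha ainj enc henc pos hpos A hA AA hAA.
suff dist : windows_rank_dist_ge n1 n2 d AA.
  split=> // z w hz hw zw zwE; have := dist z w hz hw zw.
  by rewrite zwE /rank_dist subrr mxrank0 leqNgt hd.
have m0 : 0 < m by lia.
have [_ Cdist] := hC; case: hpos => pos_inj pos_codom pos_check.
have psi_dist a b : a != b -> d <= \rank (psi a - psi b)%R.
  have [[aC _] [bC _]] := (hpsi a, hpsi b).
  by move=> ab; apply: Cdist; rewrite ?(inj_eq psi_inj).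
have psi_rank a : d <= \rank (psi a).
  (* Linearity puts 0 in the code, so rank is distance to a codeword. *)
  have [aC /eqP a0] := hpsi a; rewrite -[psi a]subr0.
  by apply: Cdist => //; apply: mem0v.
have pos_surj (ab : 'I_(n1 %/ m) * 'I_(n2 %/ m)) :
    ~~ ((ab.1 < 4) && (ab.2 < 4)) -> exists t, pos t = ab.
  by rewrite -pos_codom => /codomP[t ->]; exists t.
have kE : k_R m n1 n2 = (k_R m n1 n2)./2 + (k_R m n1 n2)./2.
  by rewrite addnn halfK (negbTE hk) subn0.
move: (k_R m n1 n2)./2 kE sigma hsigma enc henc A hA AA hAA.
move=> h kE sigma hsigma enc henc A hA AA hAA.
set M := #|F| ^ h in sigma hsigma A hA AA hAA *.
have mark i j : submx_at (4 * m) (4 * m) (A i j) 0 0 = marker m d by case: (hA i j).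
pose c i j t := enc (row_mx (sigma i) (sigma j)) ord0 t.
have symb i j t : submx_at m m (A i j) (m * (pos t).1) (m * (pos t).2) = psi (c i j t).
  by case: (hA i j).
move=> z w hz hw zw; rewrite leqNgt; apply/negP => lt_d.
have [e1 e2] : z.1 = w.1 %[mod n1] /\ z.2 = w.2 %[mod n2].
  have [[-> ->]//|/eqP ne] := eqVneq (z.1 %% n1, z.2 %% n2) (w.1 %% n1, w.2 %% n2).
  have := wdist_misaligned hm m0 hn1 hn2 hn1m hn2m hAA mark symb pos_surj
    psi_rank hz hw ne.
  by rewrite leqNgt lt_d.
have /andP[hz1 hz2] := hz; have /andP[hw1 hw2] := hw.
pose n10 := n1_gt0 m0 hn1; pose n20 := n2_gt0 m0 hn2.
have [a [b [T [Tinj kT TE]]]] := check_symbols_agree m0 hn1 hn2 hn1m hn2m hAA symb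
  pos_surj psi_dist (z := z) (w := w) hz1 hz2 hw1 hw2 pos_check e1 e2 lt_d.
have kn : h + h <= n_R m n1 n2 by rewrite -kE leq_subr.
(* Row tiles affect only the first half of the message and column tiles only the second; each window
   contributes at most one change per half. *)
pose E := lshift h @: (gray_change sigma n10 hz1 :|: gray_change sigma n10 hw1)
  :|: @rshift h h @: (gray_change sigma n20 hz2 :|: gray_change sigma n20 hw2).
have E4 : #|E| <= 4.
  have un (U V : {set 'I_h}) : #|U| <= 1 -> #|V| <= 1 -> #|U :|: V| <= 2.
    by move=> u v; rewrite (leq_trans (leq_card_setU _ _)) // (leq_add u v).
  apply: leq_trans (leq_card_setU _ _) _; apply: (@leq_add _ _ 2 2).
    by apply: leq_trans (leq_imset_card _ _) _; apply: un; apply: card_gray_change.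
  by apply: leq_trans (leq_imset_card _ _) _; apply: un; apply: card_gray_change.
have cE i j (s : 'I_(h + h)) :
    enc (row_mx (sigma i) (sigma j)) ord0 (widen_ord kn s)
    = row_mx (sigma i) (sigma j) ord0 s.
  by have [_ sys] := henc (row_mx (sigma i) (sigma j)); apply: sys.
have cz : c (tile n10 hz1 a) (tile n20 hz2 b) =1 c (tile n10 hw1 a) (tile n20 hw2 b).
  move=> t; congr (fun_of_matrix _ ord0 t).
  apply: (reed_solomon_eq ainj (proj1 (henc _)) (proj1 (henc _))).
  apply: (leq_card_agree (kn := kn) E4 Tinj) => [q|s sE|q]; first by rewrite -kE.
    rewrite inE; apply/eqP.
    apply: (symbol_agree (t := widen_ord kn s) hAA symb psi_dist e1 e2 lt_d) => i j im jm.
    rewrite /c !cE; move: sE; rewrite -[s]splitK inE negb_or => /andP[].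
    case: (split s) => s' /= sl sr; rewrite !(row_mxEl, row_mxEr).
      have : s' \notin gray_change sigma n10 hz1 :|: gray_change sigma n10 hw1.
        by apply: contra sl => sl; apply: imset_f.
      rewrite inE negb_or => /andP[sz sw].
      by split; apply: gray_unchanged.
    have : s' \notin gray_change sigma n20 hz2 :|: gray_change sigma n20 hw2.
      by apply: contra sr => sr; apply: imset_f.
    rewrite inE negb_or => /andP[sz sw].
    by split; apply: gray_unchanged.
  by rewrite inE; apply/eqP/TE.
(* Equal codewords give equal messages, hence equal tiles at [(a, b)]; with equal residues these
   determine the window. *)
have sE : row_mx (sigma (tile n10 hz1 a)) (sigma (tile n20 hz2 b)) =
          row_mx (sigma (tile n10 hw1 a)) (sigma (tile n20 hw2 b)).
  by apply/rowP => s; rewrite -!cE; apply: cz.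
have [s1 s2] := eq_row_mx sE; have [sinj _] := hsigma; have {}sinj := bij_inj sinj.
apply: zw; rewrite (surjective_pairing z) (surjective_pairing w).
by rewrite (tile_val_eq e1 (sinj _ _ s1)) (tile_val_eq e2 (sinj _ _ s2)).
Qed.
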